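(* Let $b\in\mathbb{N}$ with $b\geq 2$ and $b\neq 3$. Then the number of integers $a$ with $1\leq a\leq b-1$, $(a,b)=1$ and $S(1,a,b)=\frac{b}{2}$ equals $$\phi\left(b,1,\left\lfloor \frac{b-1}{3}\right\rfloor\right).$$
   Context: $\mathbb{N}$ denotes the positive integers and $(a,b)$ the greatest common divisor. For $n,a,b\in\mathbb{N}$ with $b\geq 2$, define $$S(n,a,b):=\sum_{m=1}^{b-1}\cot\left(\frac{\pi m}{b}\right)\sin^{3}\left(2\pi mn\frac{a}{b}\right).$$ The generalized totient function is $$\phi(n,A,B):=\sum_{\substack{A\leq k\leq B\\ (n,k)=1}}1,$$ the number of integers $k$ with $A\leq k\leq B$ and $(n,k)=1$ (equal to $0$ if there are none). *)

(* Defs.v *)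
From mathcomp Require Import all_boot all_order all_algebra.
From mathcomp Require Import reals trigo.

Set Implicit Arguments.
Unset Strict Implicit.
Unset Printing Implicit Defensive.

Import Order.TTheory GRing.Theory Num.Theory.

Local Open Scope ring_scope.

Definition cot {R : realType} (x : R) : R := cos x / sin x.

Definition cot_sin3_sum (R : realType) (n a b : nat) : R :=
  \sum_(1 <= m < b)
    cot (pi * m%:R / b%:R) * sin (2 * pi * m%:R * n%:R * (a%:R / b%:R)) ^+ 3.

(* The upper bound B is inclusive; the sum is empty when B < A. *)
Definition gen_totient (n A B : nat) : nat :=
  (\sum_(A <= k < B.+1 | coprime n k) 1)%N.

(* Main.v *)
Require Import Defs.
From mathcomp Require Import all_boot all_order all_algebra.
From mathcomp Require Import reals trigo.
From mathcomp Require Import ring lra zify.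

Import Order.TTheory GRing.Theory Num.Theory.
Local Open Scope ring_scope.

(** Linearising the cube, sin^3 x = (3 sin x - sin 3x) / 4, reduces S(1,a,b) to
    the sums F(k) = sum_m cot(pi m/b) sin(2 pi m k/b).  The difference
    F(k+1) - F(k) is a sum of cosines, since
    cot x (sin 2(k+1)x - sin 2kx) = cos 2(k+1)x + cos 2kx, whence
    F(k) = b - 2k for 0 < k < b, and F is b-periodic.  For a coprime to b <> 3
    neither a nor 3a is divisible by b, and so S(1,a,b) = (1 - floor(3a/b)) b/2,
    which is b/2 exactly when 3a < b. *)

Section TrigonometricSums.
Context {R : realType}.
Implicit Types (x : R) (b k m n : nat).

Lemma sin_cube x : sin x ^+ 3 = (3 * sin x - sin (3 * x)) / 4.
Proof.
have -> : 3 * x = x *+ 2 + x by ring.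
rewrite sinD sin_mulr2n cos_mulr2n.
have := sin2cos2 x; move: (sin x) (cos x) => s c h.
have -> : c ^+ 2 = 1 - s ^+ 2 by rewrite h; ring.
have -> : (c * s) *+ 2 * c = c ^+ 2 * s *+ 2 by ring.
have -> : c ^+ 2 = 1 - s ^+ 2 by rewrite h; ring.
by field.
Qed.

(** The sine difference is [2 * cos u * sin x], whose factor [sin x] cancels the denominator of
    [cot x]. *)
Lemma cot_mul_sin_diff x u : sin x != 0 ->
  cot x * (sin (u + x) - sin (u - x)) = cos (u + x) + cos (u - x).
Proof. by move=> sx0; rewrite /cot sinD sinB cosD cosB; field. Qed.

Lemma sinB_nat2pi n x : sin (n%:R * (2 * pi) - x) = - sin x.
Proof.
have -> : n%:R * (2 * pi) - x = - x + (pi *+ 2) *+ n by ring.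
by rewrite (periodicn (@sinD2pi R)) sinN.
Qed.

Lemma sin_pi_frac_neq0 b k : (0 < k < b)%N ->
  sin (pi * k%:R / b%:R : R) != 0.
Proof.
move=> /andP[k0 kb]; rewrite gt_eqF// sin_gt0_pi//.
have b0 : 0 < b%:R :> R by rewrite ltr0n (leq_trans _ kb).
apply/andP; split; first by rewrite divr_gt0 // mulr_gt0 ?pi_gt0 ?ltr0n.
by rewrite ltr_pdivrMr// ltr_pM2l ?pi_gt0// ltr_nat.
Qed.

(** With y = pi k/b, multiplying by 2 sin y turns each term into sin((2m+1)y) - sin((2m-1)y). The
    sum telescopes to sin(2 pi k - y) - sin y = -2 sin y, and sin y is nonzero because 0 < k < b. *)
Lemma sum_cos_roots b k : (0 < k < b)%N ->
  \sum_(1 <= m < b) cos (2 * k%:R * (pi * m%:R / b%:R)) = -1 :> R.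
Proof.
move=> kb; have b0 : (0 < b)%N by lia.
have bR : b%:R != 0 :> R by rewrite pnatr_eq0 -lt0n.
have sy := sin_pi_frac_neq0 _ _ kb.
set y := pi * k%:R / b%:R in sy.
have twosy : 2 * sin y != 0 by rewrite mulf_neq0// pnatr_eq0.
apply: (mulfI twosy); rewrite mulr_sumr.
rewrite (telescope_sumr_eq (fun m => sin ((2 * m%:R - 1) * y)))//.
  have -> : (2 * b%:R - 1) * y = k%:R * (2 * pi) - y by rewrite /y; field.
  have -> : (2 * 1 - 1) * y = y by ring.
  by rewrite sinB_nat2pi; ring.
move=> m _.
have -> : 2 * k%:R * (pi * m%:R / b%:R) = 2 * m%:R * y by rewrite /y; field.
have -> : (2 * m.+1%:R - 1) * y = 2 * m%:R * y + y by rewrite -natr1; ring.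
have -> : (2 * m%:R - 1) * y = 2 * m%:R * y - y by ring.
by rewrite sinD sinB; ring.
Qed.

(** This is F(k), with the sine's angle written as a multiple of the argument of [cot]. *)
Definition cot_sin_sum b k : R :=
  \sum_(1 <= m < b)
    cot (pi * m%:R / b%:R) * sin (2 * k%:R * (pi * m%:R / b%:R)).

Lemma cot_sin_sumS b k :
  cot_sin_sum b k.+1 - cot_sin_sum b k =
  \sum_(1 <= m < b) cos (2 * k.+1%:R * (pi * m%:R / b%:R)) +
  \sum_(1 <= m < b) cos (2 * k%:R * (pi * m%:R / b%:R)).
Proof.
rewrite /cot_sin_sum -sumrB -big_split /=; apply: eq_big_nat => m mb.
have := sin_pi_frac_neq0 _ _ mb; set x := pi * _ / _ => sx.
have -> : 2 * k.+1%:R * x = (2 * k%:R + 1) * x + x by rewrite -natr1; ring.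
have -> : 2 * k%:R * x = (2 * k%:R + 1) * x - x by ring.
by rewrite -mulrBr cot_mul_sin_diff.
Qed.

Lemma cot_sin_sumE b k : (0 < k < b)%N -> cot_sin_sum b k = b%:R - 2 * k%:R.
Proof.
elim: k => // k IHk /= kb.
have := cot_sin_sumS b k; rewrite (sum_cos_roots b k.+1)//.
(* From k = 0 the second cosine sum is b - 1, so F rises from 0 to b - 2; every later step adds -1 -
   1 = -2. *)
have [->|k0] := posnP k.
  have -> : cot_sin_sum b 0 = 0.
    by rewrite /cot_sin_sum big1// => m _; rewrite mulr0 mul0r sin0 mulr0.
  under eq_bigr => m _ do rewrite mulr0 mul0r cos0.
  rewrite sumr_const_nat natrB; last by lia.
  by lra.
rewrite sum_cos_roots ?k0 ?(ltn_trans _ kb)// IHk ?k0 ?(ltn_trans _ kb)//.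
by rewrite -natr1; lra.
Qed.

Lemma cot_sin_sum_mod b k : (0 < b)%N ->
  cot_sin_sum b (k %% b) = cot_sin_sum b k.
Proof.
move=> b0; have bR : b%:R != 0 :> R by rewrite pnatr_eq0 -lt0n.
apply: eq_bigr => m _; congr (_ * _).
rewrite [in RHS](divn_eq k b) natrD natrM.
set q := (k %/ b)%N; set r := (k %% b)%N.
(* The multiple q b of b contributes q m full turns. *)
have -> : 2 * (q%:R * b%:R + r%:R) * (pi * m%:R / b%:R) =
  2 * r%:R * (pi * m%:R / b%:R) + (pi *+ 2) *+ (q * m) :> R.
  by rewrite -[_ *+ (q * m)]mulr_natr natrM; field.
by rewrite (periodicn (@sinD2pi R)).
Qed.

Lemma cot_sin3_sum_cot_sin_sum a b :
  cot_sin3_sum R 1 a b = (3 * cot_sin_sum b a - cot_sin_sum b (3 * a)) / 4.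
Proof.
rewrite /cot_sin3_sum /cot_sin_sum mulr_sumr -sumrB mulr_suml.
apply: eq_big_nat => m mb.
have bR : b%:R != 0 :> R by rewrite pnatr_eq0; lia.
rewrite sin_cube natrM.
have -> : 2 * pi * m%:R * 1 * (a%:R / b%:R) =
  2 * a%:R * (pi * m%:R / b%:R) :> R by field.
by rewrite [3 * (2 * _ * _)]mulrA [3 * (2 * _)]mulrCA; field.
Qed.

Lemma cot_sin3_sumE a b : (0 < a < b)%N -> coprime a b -> b <> 3%N ->
  cot_sin3_sum R 1 a b = (1 - (3 * a %/ b)%:R) * (b%:R / 2).
Proof.
move=> ab cab b3; have b0 : (0 < b)%N by lia.
(* By coprimality, b dividing 3a would force b to divide 3; b = 1 contradicts 0 < a < b, and b = 3
   is excluded. *)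
have r0 : (0 < 3 * a %% b)%N.
  rewrite lt0n; apply/negP; rewrite -/(b %| 3 * a)%N.
  rewrite Gauss_dvdl 1?coprime_sym// dvdn_divisors// !inE.
  by move=> /orP[/eqP|/eqP]; lia.
rewrite cot_sin3_sum_cot_sin_sum -(cot_sin_sum_mod b (3 * a))//.
rewrite !cot_sin_sumE ?r0 ?ltn_mod//.
(* With q the quotient and r the remainder, 3(b - 2a) - (b - 2r) = 2b(1 - q). *)
have -> : (3 * a %% b)%:R = 3 * a%:R - (3 * a %/ b)%:R * b%:R :> R.
  by rewrite -!natrM {2}(divn_eq (3 * a) b) natrD addrC addKr.
by field.
Qed.

Lemma cot_sin3_sum_eq_half a b : (0 < a < b)%N -> coprime a b -> b <> 3%N ->
  (cot_sin3_sum R 1 a b == b%:R / 2) = (3 * a < b)%N.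
Proof.
move=> ab cab b3; have b0 : (0 < b)%N by lia.
have h0 : b%:R / 2 != 0 :> R by rewrite mulf_neq0 ?invr_eq0 ?pnatr_eq0; lia.
(* The equation becomes -q b/2 = 0, that is, q = 0. *)
rewrite cot_sin3_sumE// -subr_eq0 -[X in _ - X]mul1r -mulrBl addrAC subrr add0r.
by rewrite mulf_eq0 (negPf h0) orbF oppr_eq0 pnatr_eq0 -leqn0 leqNgt divn_gt0// -ltnNge.
Qed.

End TrigonometricSums.

Theorem corollary1p6 (R : realType) (b : nat) (hb2 : (2 <= b)%N)
    (hb3 : b <> 3%N) :
  #|[set a : 'I_b | [&& (1 <= a)%N, coprime a b &
                    cot_sin3_sum R 1 a b == b%:R / 2]]|
  = gen_totient b 1 ((b - 1) %/ 3).
Proof.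
rewrite -sum1dep_card.
rewrite -(big_mkord (fun a => [&& (1 <= a)%N, coprime a b &
  cot_sin3_sum R 1 a b == b%:R / 2]) (fun=> 1%N)).
(* Both counts are put over 0 <= a < b, the totient's bounds moving into its predicate. *)
rewrite /gen_totient [RHS](big_nat_widen _ _ b); last by lia.
rewrite [RHS](big_nat_widenl 1 0)// big_nat_cond [RHS]big_nat_cond.
apply: eq_bigl => a; apply: andb_id2l => /= ab.
rewrite [coprime b a]coprime_sym.
have [->|a0] := posnP a; first by rewrite andbF.
rewrite andbT /=; apply: andb_id2l => cab.
(* For integers, 3a < b means 3a <= b - 1, hence the floor of (b - 1)/3. *)
by rewrite cot_sin3_sum_eq_half ?a0//; lia.
Qed.
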